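(* Let $\mathcal Y$ be a finite set, $y_0\ne y_1$ in $\mathcal Y$, $\pi\in[0,1]$, and let $\{\alpha_0(y)\}_{y\ne y_0}$, $\{\alpha_1(y)\}_{y\ne y_1}$ be nonnegative reals. Let $H_\infty$ be the compound-Poisson vector defined in the context, $p_\infty(h):=\mathbb P(H_\infty=h)$, $e:=e_{y_1}-e_{y_0}$, $P_\infty:=\mathcal L(H_\infty)$ and $Q_\infty:=\mathcal L(H_\infty+e)$, so that $Q_\infty(h)=p_\infty(h-e)$. Then for every $\varepsilon\ge0$, $$\delta_{Q_\infty\|P_\infty}(\varepsilon)=\sum_{h\in\mathbb Z^{\mathcal Y}}\bigl(p_\infty(h-e)-e^{\varepsilon}p_\infty(h)\bigr)_+.\qquad( * )$$ Moreover: (a) If $|\mathcal Y|=2$, the series $( * )$ reduces to the Skellam series $\sum_{d\in\mathbb Z}\bigl(s(d-1)-e^{\varepsilon}s(d)\bigr)_+$, where $s$ is the probability mass function of $\mathrm{Skellam}(\lambda_0,\lambda_1)$. (b) If $\pi=0$ (respectively $\pi=1$), then the limit histogram law is generated only by the $0$-group (respectively only by the $1$-group), but the boundary experiment factors into a scalar Poisson-shift on the switched coordinate and common independent noise on the remaining coordinates. For $\pi=0$, under the coordinate map $h\mapsto(h_y)_{y\ne y_0}$, $$P_\infty\simeq\mathrm{Poi}(\alpha_0(y_1))\otimes\bigotimes_{y\in\mathcal Y\setminus\{y_0,y_1\}}\mathrm{Poi}(\alpha_0(y)),$$ whereas $$Q_\infty\simeq\bigl(1+\mathrm{Poi}(\alpha_0(y_1))\bigr)\otimes\bigotimes_{y\in\mathcal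 Y\setminus\{y_0,y_1\}}\mathrm{Poi}(\alpha_0(y)).$$ Hence the boundary privacy curve is exactly the scalar Poisson-shift series $$\sum_{j\ge0}\bigl(r_\lambda(j-1)-e^{\varepsilon}r_\lambda(j)\bigr)_+$$ with parameter $\lambda=\alpha_0(y_1)$, where $r_\lambda$ is the probability mass function of $\mathrm{Poi}(\lambda)$ and $r_\lambda(-1):=0$. In particular, extra active coordinates contribute only common independent noise and do not affect the privacy profile. The case $\pi=1$ is symmetric with $y_0$ replacing $y_1$.
   Context: $e_y$ is the standard basis of $\mathbb Z^{\mathcal Y}$. The vector $H_\infty$ is $$H_\infty:=\sum_{y\ne y_0}U_y(e_y-e_{y_0})+\sum_{y\neq y_1}V_y(e_y-e_{y_1})\in\mathbb Z^{\mathcal Y},$$ with all $U_y\sim\mathrm{Poi}((1-\pi)\alpha_0(y))$, $V_y\sim\mathrm{Poi}(\pi\alpha_1(y))$ independent; $\mathrm{Poi}(0)$ is the point mass at $0$. The $U_y$ come from the $0$-group (users with input $0$, dominant output $y_0$) and the $V_y$ from the $1$-group (users with input $1$, dominant output $y_1$). $\mathrm{Skellam}(\lambda_0,\lambda_1)$ is the law of $X-Y$ with $X\sim\mathrm{Poi}(\lambda_0)$, $Y\sim\mathrm{Poi}(\lambda_1)$ independent; in (a), $\lambda_0$ and $\lambda_1$ are identified as $(1-\pi)\alpha_0(y_1)$ and $\pi\alpha_1(y_0)$. $1+\mathrm{Poi}(\lambda)$ is the law of $1+X$, $X\sim\mathrm{Poi}(\lambda)$, and a scalar Poisson-shift is a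 pair $(\mathrm{Poi}(\lambda),1+\mathrm{Poi}(\lambda))$. $(u)_+:=\max\{u,0\}$. The privacy curve (privacy profile) is $\delta_{Q\|P}(\varepsilon):=\sup_A\{Q(A)-e^{\varepsilon}P(A)\}$ over measurable sets $A$. $P\simeq P'$ means that $P'$ is the image of $P$ under the stated coordinate map (which is injective on $\{h:\sum_yh_y=0\}$, where $P_\infty,Q_\infty$ are concentrated).
   Formalization: For π=1, with Q_∞ = law of H_∞+e kept fixed, the y_0-coordinate of Q_∞ is Poi−1, so the literal mirrored claim fails; it is stated for the law of H_∞−e (and for δ_{P_∞‖Q_∞}), and for Q_∞ itself with −1+Poi and the reversed series. *)

(* Defs.v *)
(* MathComp-Analysis, over an abstract R : realType. *)
From HB Require Import structures.
From mathcomp Require Import all_boot all_order all_algebra.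
From mathcomp Require Import all_classical all_reals all_analysis.

Set Implicit Arguments.
Unset Strict Implicit.
Unset Printing Implicit Defensive.

Import Order.TTheory GRing.Theory Num.Theory.

Local Open Scope classical_set_scope.
Local Open Scope ring_scope.

(* Z and Z^I (I finite) carry the discrete sigma-algebra. *)
HB.instance Definition _ := isPointed.Build int 0.
HB.instance Definition _ := @isMeasurable.Build default_measure_display
  int discrete_measurable discrete_measurable0
  discrete_measurableC discrete_measurableU.

HB.instance Definition _ (I : finType) :=
  isPointed.Build {ffun I -> int} 0.
HB.instance Definition _ (I : finType) :=
  @isMeasurable.Build default_measure_display
  {ffun I -> int} discrete_measurable discrete_measurable0
  discrete_measurableC discrete_measurableU.

Section Generic.
Context {R : realType}.

Definition mass {T : Type} (mu : set T -> \bar R) (x : T) : R :=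
  fine (mu [set x]).

Definition pos_part (u : R) : R := Num.max u 0.

Definition privacy_curve {d} {T : measurableType d} (Q P : probability T R)
    (eps : R) : \bar R :=
  ereal_sup [set (Q A - (expR eps)%:E * P A)%E | A in measurable].

Definition mutually_independent {d d'} {Omega : measurableType d}
    {T : measurableType d'} (P : probability Omega R) {J : finType}
    (X : J -> {RV P >-> T}) (I : {pred J}) : Prop :=
  forall K : {set J}, K \subset I ->
  forall B : J -> set T, (forall k, measurable (B k)) ->
    P (\bigcap_(k in [set` K]) (X k @^-1` B k)) =
    (\prod_(k in K) P (X k @^-1` B k))%E.

(* The factors live on the countable discrete space Z, so their product measure
   is the one whose mass at h is the product of the masses at the h i. *)
Definition product_law {I : finType} (mu : I -> probability int R)
    (A : set {ffun I -> int}) : \bar R :=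
  \esum_(h in A) (\prod_(i : I) mu i [set h i])%E.

End Generic.

Section Poisson.
Context {R : realType}.

(* [poisson_prob] ignores its second argument, and is the point mass at 0 when
   the rate is 0; [poisson_pmf] is not the mass function at rate 0. *)
Definition Poi (lambda : R) : probability nat R := poisson_prob lambda 0%N.

Definition int_shift (k : int) (n : nat) : int := k + n%:Z.

Lemma measurable_int_shift k : measurable_fun setT (int_shift k).
Proof. by []. Qed.
HB.instance Definition _ k :=
  isMeasurableFun.Build _ _ _ _ (int_shift k) (@measurable_int_shift k).

(* The law on Z of k + X with X ~ Poi(lambda). *)
Definition shifted_Poi (k : int) (lambda : R) : probability int R :=
  distribution (Poi lambda) (int_shift k).

Definition Skellam (lambda0 lambda1 : R) : set int -> \bar R :=
  pushforward (Poi lambda0 \x Poi lambda1)%E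
    (fun xy : nat * nat => xy.1%:Z - xy.2%:Z).

End Poisson.

Section Histogram.
Context {Y : finType}.

Definition unit_vec (y : Y) : {ffun Y -> int} := [ffun z => (z == y)%:R].

Definition translate (v h : {ffun Y -> int}) : {ffun Y -> int} := h + v.

Lemma measurable_translate v : measurable_fun setT (translate v).
Proof. by []. Qed.
HB.instance Definition _ v :=
  isMeasurableFun.Build _ _ _ _ (translate v) (@measurable_translate v).

Definition drop_coord (y0 : Y) (h : {ffun Y -> int}) :
    {ffun {y : Y | y != y0} -> int} :=
  [ffun y => h (val y)].

Lemma measurable_drop_coord y0 : measurable_fun setT (drop_coord y0).
Proof. by []. Qed.
HB.instance Definition _ y0 :=
  isMeasurableFun.Build _ _ _ _ (drop_coord y0) (@measurable_drop_coord y0).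

End Histogram.

Section CountableMeasurability.
Context {d d' : measure_display} {Omega : measurableType d}
  {T : measurableType d'} {C : countType}.

Lemma measurable_countable_comp (X : Omega -> C) (f : C -> T) :
  (forall c, measurable (X @^-1` [set c])) -> measurable_fun setT (f \o X).
Proof.
move=> mX _ B _; rewrite setTI.
rewrite (_ : _ @^-1` _ =
    \bigcup_c (if c \in f @^-1` B then X @^-1` [set c] else set0)); last first.
  rewrite -bigcup_mkcond.
  by apply/seteqP; split=> [w /= Bw|w [c /= Bc Xc]]; [exists (X w)|rewrite /= Xc].
apply: countable_bigcupT_measurable => [|c]; first exact: countableP.
by case: ifP => // _; exact: mX.
Qed.

End CountableMeasurability.

Section CompoundPoisson.
Context {Y : finType} {d : measure_display} {Omega : measurableType d}.

Definition group_sum (y0 : Y) (U : Y -> {mfun Omega >-> nat}) (w : Omega) :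
    {ffun Y -> int} :=
  \sum_(y | y != y0) (unit_vec y - unit_vec y0) *+ U y w.

Lemma measurable_values (U : Y -> {mfun Omega >-> nat}) (c : {ffun Y -> nat}) :
  measurable ((fun w => [ffun y => U y w]) @^-1` [set c]).
Proof.
rewrite (_ : _ @^-1` _ = \bigcap_(y in [set: Y]) (U y @^-1` [set c y])).
  by apply: fin_bigcap_measurable => // y _; rewrite -[X in measurable X]setTI;
    exact: measurable_funPT.
apply/seteqP; split=> [w /= <- y _ /=|w /= cw]; first by rewrite ffunE.
by apply/ffunP => y; rewrite ffunE; exact: cw.
Qed.

Lemma measurable_group_sum y0 U : measurable_fun setT (group_sum y0 U).
Proof.
rewrite (_ : group_sum y0 U =
  (fun c : {ffun Y -> nat} =>
     \sum_(y | y != y0) (unit_vec y - unit_vec y0) *+ c y) \o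
  (fun w => [ffun y => U y w])).
  by apply: measurable_countable_comp; exact: measurable_values.
by apply/funext => w; apply: eq_bigr => y _; rewrite ffunE.
Qed.
HB.instance Definition _ y0 U :=
  isMeasurableFun.Build _ _ _ _ (group_sum y0 U) (@measurable_group_sum y0 U).

Definition histogram (y0 y1 : Y) (U V : Y -> {mfun Omega >-> nat}) (w : Omega) :
    {ffun Y -> int} :=
  group_sum y0 U w + group_sum y1 V w.

Lemma measurable_histogram y0 y1 U V :
  measurable_fun setT (histogram y0 y1 U V).
Proof.
rewrite (_ : histogram y0 y1 U V =
  (fun c : {ffun Y -> int} * {ffun Y -> int} => c.1 + c.2) \o
  (fun w => (group_sum y0 U w, group_sum y1 V w))) //.
apply: measurable_countable_comp => -[a b].
rewrite (_ : _ @^-1` _ =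
  group_sum y0 U @^-1` [set a] `&` group_sum y1 V @^-1` [set b]).
  by apply: measurableI; rewrite -[X in measurable X]setTI;
    exact: measurable_group_sum.
by apply/seteqP; split=> [w /= [-> ->]|w /= [-> ->]].
Qed.
HB.instance Definition _ y0 y1 U V :=
  isMeasurableFun.Build _ _ _ _ (histogram y0 y1 U V)
    (@measurable_histogram y0 y1 U V).

End CompoundPoisson.

(* The index set of all U_y with y <> y0 and all V_y with y <> y1; the unused
   U_y0 and V_y1 are left unconstrained. *)
Definition active {Y : finType} (y0 y1 : Y) : {pred Y + Y} :=
  fun k => match k with inl y => y != y0 | inr y => y != y1 end.

Definition both_groups {Y : finType} {A : Type} (U V : Y -> A) (k : Y + Y) : A :=
  match k with inl y => U y | inr y => V y end.

(* prop1 is the proportion (written pi on paper) of users with input 1. *)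
Record limit_model {R : realType} {Y : finType} {d : measure_display}
    {Omega : measurableType d} (P : probability Omega R) (y0 y1 : Y) (prop1 : R)
    (alpha0 alpha1 : Y -> R) (U V : Y -> {RV P >-> nat}) : Prop := {
  law_U : forall y, y != y0 -> forall B : set nat,
    distribution P (U y) B = Poi ((1 - prop1) * alpha0 y) B ;
  law_V : forall y, y != y1 -> forall B : set nat,
    distribution P (V y) B = Poi (prop1 * alpha1 y) B ;
  indep_UV : mutually_independent (both_groups U V) (active y0 y1) }.

(* [unit_vec y1 - unit_vec y0] is the switch of one user from y0 to y1. *)
Definition switch_vec {Y : finType} (y0 y1 : Y) : {ffun Y -> int} :=
  unit_vec y1 - unit_vec y0.

Definition P_infty {R : realType} {Y : finType} {d : measure_display}
    {Omega : measurableType d} (P : probability Omega R) (y0 y1 : Y)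
    (U V : Y -> {RV P >-> nat}) : probability {ffun Y -> int} R :=
  distribution P (histogram y0 y1 U V).

(* If mu is the law of H, this is the law of H + v. *)
Definition shifted_law {R : realType} {Y : finType}
    (mu : probability {ffun Y -> int} R) (v : {ffun Y -> int}) :
    probability {ffun Y -> int} R :=
  distribution mu (translate v).

Definition Q_infty {R : realType} {Y : finType} {d : measure_display}
    {Omega : measurableType d} (P : probability Omega R) (y0 y1 : Y)
    (U V : Y -> {RV P >-> nat}) : probability {ffun Y -> int} R :=
  shifted_law (P_infty y0 y1 U V) (switch_vec y0 y1).

(* Indexed by Z, so that the mass at -1 is 0. *)
Definition poisson_mass {R : realType} (lambda : R) : int -> R :=
  mass (shifted_Poi 0 lambda).

Definition poisson_shift_series {R : realType} (lambda eps : R) : \bar R :=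
  (\sum_(0 <= j <oo)
    (pos_part (poisson_mass lambda (j%:Z - 1)
               - expR eps * poisson_mass lambda j%:Z))%:E)%E.

(* Main.v *)
(* On a countable discrete space the supremum defining the privacy curve is
   attained on the set where Q >= e^eps P, which gives the series.  The same
   argument shows that the curve does not change under a statistic f when the
   masses of Q and P are those of their images under f times a common factor.
   For |Y| = 2 and for a single group, take for f the coordinate that the switch
   increases or decreases: the histogram has total 0, so for |Y| = 2 this
   coordinate (a difference of two independent Poisson variables) determines it,
   and for a single group the common factor is the mass of the remaining,
   independent, coordinates. *)

Require Import Defs.
From HB Require Import structures.
From mathcomp Require Import all_boot all_order all_algebra.
From mathcomp Require Import all_classical all_reals all_analysis.
From mathcomp Require Import lra.

Import Order.TTheory GRing.Theory Num.Theory.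

Local Open Scope classical_set_scope.
Local Open Scope ring_scope.

(** * Measures and privacy curves on countable discrete spaces *)

Section Discrete.
Context {R : realType} {d : measure_display} {T : measurableType d}.
Hypothesis countT : countable [set: T].
Hypothesis measurable_all : forall A : set T, measurable A.

(** An injection of [T] into the natural numbers cuts [A] into a disjoint sequence of pieces, each
    empty or a singleton, so countable additivity gives the sum. *)
Lemma measure_esum_points (mu : {measure set T -> \bar R}) (A : set T) :
  mu A = \esum_(x in A) mu [set x].
Proof.
have /countable_injP[f injf] := countT.
pose F n := A `&` f @^-1` [set n].
have AE : A = \bigcup_n F n.
  by apply/seteqP; split=> [x Ax|x [n _ []]//]; exists (f x).
have tF : trivIset [set: nat] F.
  by move=> i j _ _ [x [[_ /= <-] [_ /= <-]]].
rewrite [in RHS]AE nneseries_sum_bigcup// [in LHS]AE measure_semi_bigcup//.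
apply: eq_eseriesr => n _.
have [->|/set0P[x [Ax fx]]] := eqVneq (F n) set0.
  by rewrite measure0 esum_set0.
have -> : F n = [set x].
  apply/seteqP; split=> [y [Ay fy]|y -> //]; apply: injf; rewrite ?inE//.
  by rewrite fy fx.
by rewrite esum_set1.
Qed.

Lemma massE (mu : probability T R) x : mu [set x] = (mass mu x)%:E.
Proof. by rewrite /mass fineK// fin_num_measure. Qed.

Lemma mass_ge0 (mu : probability T R) x : 0 <= mass mu x.
Proof. by rewrite -lee_fin -massE. Qed.

Lemma probability_esum_mass (mu : probability T R) (A : set T) :
  mu A = \esum_(x in A) (mass mu x)%:E.
Proof.
by rewrite (measure_esum_points mu); apply: eq_esum => x _; exact: massE.
Qed.

(** The scaled measure is again a measure, so the sum over points applies to it directly. *)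
Lemma scaled_probability_esum_mass (r : R) (mu : probability T R) (A : set T) :
  0 <= r -> (r%:E * mu A)%E = \esum_(x in A) (r * mass mu x)%:E.
Proof.
move=> r0; have := measure_esum_points (mscale (NngNum r0) mu) A.
rewrite /= {1}/mscale /= => ->; apply: eq_esum => x _.
by rewrite EFinM -(massE mu).
Qed.

(* Neyman-Pearson: the supremum is attained on any B separating the signs of
   Q - e^eps P. *)
Lemma privacy_curve_attained (Q P : probability T R) (eps : R) (B : set T) :
  (forall x, B x -> expR eps * mass P x <= mass Q x) ->
  (forall x, ~ B x -> mass Q x <= expR eps * mass P x) ->
  privacy_curve Q P eps = (Q B - (expR eps)%:E * P B)%E.
Proof.
move=> BQ nBQ; apply/eqP; rewrite eq_le; apply/andP; split; last first.
  by apply: ereal_sup_ubound; exists B.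
apply: ge_ereal_sup => _ [A _ <-].
have fP C : P C \is a fin_num by apply: fin_num_measure.
have fQ C : Q C \is a fin_num by apply: fin_num_measure.
(* Packing e^eps P as a measure gives it additivity on the same footing as [Q]. *)
pose cP : {measure set T -> \bar R} := mscale (NngNum (expR_ge0 eps)) P.
have cPE C : cP C = \esum_(x in C) (expR eps * mass P x)%:E.
  exact: scaled_probability_esum_mass (expR_ge0 eps).
have on_B C : C `<=` B -> (cP C <= Q C)%E.
  move=> CB; rewrite probability_esum_mass cPE.
  by apply: le_esum => x /CB /BQ; rewrite lee_fin.
have off_B C : C `<=` ~` B -> (Q C <= cP C)%E.
  move=> CB; rewrite probability_esum_mass cPE.
  by apply: le_esum => x /CB /nBQ; rewrite lee_fin.
have fcP C : cP C \is a fin_num by rewrite fin_numM// fin_num_measure.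
rewrite -![((expR eps)%:E * P _)%E]/(cP _).
(* Only the two set differences tell [A] from [B]: [Q - cP] is nonpositive on the part of [A]
   outside [B] and nonnegative on the part of [B] outside [A]. All values are finite, so linear
   arithmetic over [R] concludes. *)
have := off_B (A `\` B) (fun x => @proj2 _ _).
have := on_B (B `\` A) (@subDsetl _ _ _).
have QDI C D : Q C = (Q (C `\` D) + Q (C `&` D))%E by exact: measureDI.
have cPDI C D : cP C = (cP (C `\` D) + cP (C `&` D))%E by exact: measureDI.
rewrite (QDI A B) (cPDI A B) (QDI B A) (cPDI B A).
rewrite [B `&` A]setIC -(fineK (fQ (A `\` B))) -(fineK (fQ (B `\` A))).
rewrite -(fineK (fQ (A `&` B)))
  -(fineK (fcP (A `\` B))) -(fineK (fcP (B `\` A))).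
rewrite -(fineK (fcP (A `&` B))) -!EFinD !lee_fin.
lra.
Qed.

Lemma privacy_curve_esum (Q P : probability T R) (eps : R) :
  privacy_curve Q P eps =
  \esum_(x in [set: T]) (pos_part (mass Q x - expR eps * mass P x))%:E.
Proof.
pose B := [set x | expR eps * mass P x <= mass Q x].
rewrite (@privacy_curve_attained _ _ _ B)//; last first.
  by move=> x /negP; rewrite -ltNge => /ltW.
(* On [B] the positive part is the difference itself, so adding back e^eps P recovers [Q B]; this
   finite term then cancels. Off [B] the positive part is 0. *)
have -> : Q B = (\esum_(x in B) (pos_part (mass Q x - expR eps * mass P x))%:E
                + (expR eps)%:E * P B)%E.
  rewrite probability_esum_mass scaled_probability_esum_mass ?expR_ge0//.
  rewrite -esumD//.
  - apply: eq_esum => x Bx.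
    by rewrite -EFinD /pos_part max_l ?subr_ge0// subrK.
  - by move=> x _; rewrite lee_fin /pos_part le_max lexx orbT.
  - by move=> x _; rewrite lee_fin mulr_ge0 ?expR_ge0 ?mass_ge0.
rewrite addeK; last by rewrite fin_numM// fin_num_measure.
rewrite esum_mkcond; apply: eq_esum => x _; case: ifPn => //.
rewrite notin_setE => /negP; rewrite -ltNge => ltx.
by rewrite /pos_part max_r// subr_le0 ltW.
Qed.

End Discrete.

Lemma eq_privacy_curve {R : realType} {d} {T : measurableType d}
    (Q P Q' P' : probability T R) (eps : R) :
  (forall A, Q A = Q' A) -> (forall A, P A = P' A) ->
  privacy_curve Q P eps = privacy_curve Q' P' eps.
Proof.
move=> QE PE; rewrite /privacy_curve; congr ereal_sup.
by apply/seteqP; split=> _ [A mA <-]; exists A => //; rewrite QE PE.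
Qed.

(* The masses of Q and P have the common factor w, so their likelihood ratio is
   a function of the statistic f. *)
Lemma privacy_curve_sufficient {R : realType}
    {d d'} {T : measurableType d} {T' : measurableType d'}
    (countT : countable [set: T]) (mT : forall A : set T, measurable A)
    (countT' : countable [set: T']) (mT' : forall A : set T', measurable A)
    (Q P : probability T R) (Q' P' : probability T' R)
    (f : T -> T') (w : T -> R) (eps : R) :
  (forall B, Q (f @^-1` B) = Q' B) -> (forall B, P (f @^-1` B) = P' B) ->
  (forall x, 0 <= w x) ->
  (forall x, mass Q x = w x * mass Q' (f x)) ->
  (forall x, mass P x = w x * mass P' (f x)) ->
  privacy_curve Q P eps = privacy_curve Q' P' eps.
Proof.
move=> QE PE w0 mQ mP.
pose B := [set x | expR eps * mass P' x <= mass Q' x].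
rewrite (@privacy_curve_attained _ _ _ countT' mT' _ _ _ B)//; last first.
  by move=> x /negP; rewrite -ltNge => /ltW.
(* The preimage under [f] of the optimal set in [T'] is optimal in [T], because a nonnegative factor
   [w] preserves the inequality between the masses. *)
rewrite -QE -PE; apply: privacy_curve_attained => // x Bx.
  by rewrite mQ mP mulrCA ler_wpM2l.
rewrite mQ mP mulrCA ler_wpM2l// ltW// ltNge; exact/negP.
Qed.

(** * Masses of shifted laws, and the switch vector *)

Lemma countable_int : countable [set: int].
Proof. exact: countableP. Qed.

Lemma measurable_set_int (A : set int) : measurable A.
Proof. by []. Qed.

Lemma countable_ffun_int (I : finType) : countable [set: {ffun I -> int}].
Proof. exact: countableP. Qed.

Lemma measurable_set_ffun_int (I : finType) (A : set {ffun I -> int}) :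
  measurable A.
Proof. by []. Qed.

Lemma mass_shifted_Poi {R : realType} (k : int) (lam : R) (j : int) :
  mass (shifted_Poi k lam) j = poisson_mass lam (j - k).
Proof.
rewrite /poisson_mass /mass /shifted_Poi /distribution /pushforward.
congr (fine (Poi lam _)); apply/seteqP; split=> n /=; rewrite /int_shift add0r.
  by move=> <-; rewrite addrAC subrr add0r.
by move=> ->; rewrite addrC subrK.
Qed.

Lemma mass_shifted_law {R : realType} {Y : finType}
    (mu : probability {ffun Y -> int} R) (v h : {ffun Y -> int}) :
  mass (shifted_law mu v) h = mass mu (h - v).
Proof.
rewrite /mass /shifted_law /distribution /pushforward.
congr (fine (mu _)); apply/seteqP; split=> g /=; rewrite /translate.
  by move=> <-; rewrite addrK.
by move=> ->; rewrite subrK.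
Qed.

Lemma shifted_law0 {R : realType} {Y : finType}
    (mu : probability {ffun Y -> int} R) (A : set {ffun Y -> int}) :
  shifted_law mu 0 A = mu A.
Proof.
rewrite /shifted_law /distribution /pushforward; congr (mu _).
by apply/seteqP; split=> g /=; rewrite /translate addr0.
Qed.

Lemma switch_vecE {Y : finType} (y0 y1 y : Y) :
  switch_vec y0 y1 y = (y == y1)%:R - (y == y0)%:R.
Proof. by rewrite !ffunE. Qed.

Lemma switch_vecN {Y : finType} (y0 y1 : Y) :
  - switch_vec y0 y1 = switch_vec y1 y0.
Proof. by rewrite /switch_vec opprB. Qed.

Lemma sum_switch_vec {Y : finType} (y0 y1 : Y) :
  \sum_y switch_vec y0 y1 y = 0.
Proof.
have sum1 (z : Y) : \sum_y (y == z)%:R = 1 :> int.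
  by rewrite (bigD1 z)//= eqxx big1 ?addr0// => y /negPf ->.
by under eq_bigr do rewrite switch_vecE; rewrite sumrB !sum1 subrr.
Qed.

(** * Histograms generated by a single group with dominant output [a] *)

Section SingleGroup.
Context {R : realType} {Y : finType} {a : Y} {d : measure_display}
  {Omega : measurableType d} {P : probability Omega R}
  {W : Y -> {RV P >-> nat}} {lam : Y -> R}.
Hypothesis law_W : forall y, y != a -> forall B : set nat,
  distribution P (W y) B = Poi (lam y) B.
Hypothesis indep_W : mutually_independent W (fun y => y != a).

Lemma group_sum_coord (w : Omega) (y : Y) : y != a ->
  group_sum a W w y = (W y w)%:Z.
Proof.
move=> ya; rewrite /group_sum sum_ffunE (bigD1 y)//= big1 ?addr0.
  by rewrite ffunMnE !ffunE eqxx (negPf ya) subr0 -[LHS]/((W y w)%:R) natz.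
move=> z /andP[za zy].
by rewrite ffunMnE !ffunE (negPf ya) eq_sym (negPf zy) subr0 mul0rn.
Qed.

Lemma group_sum_total (w : Omega) : \sum_y group_sum a W w y = 0.
Proof.
rewrite /group_sum; under eq_bigr do rewrite sum_ffunE.
rewrite exchange_big big1//= => y ya; under eq_bigr do rewrite ffunMnE.
by rewrite sumrMnl (sum_switch_vec a y) mul0rn.
Qed.

(** The event is an intersection of one constraint per variable, so independence factors it. The
    offset [k] serves both the shifted law and, with [k] zero, the point masses. *)
Lemma probability_group_values (k g : Y -> int) :
  P [set w | forall y, y != a -> k y + (W y w)%:Z = g y] =
  (\prod_(y | y != a) shifted_Poi (k y) (lam y) [set g y])%E.
Proof.
pose K : {set Y} := [set y | y != a]%SET.
have -> : [set w | forall y, y != a -> k y + (W y w)%:Z = g y] =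
    \bigcap_(y in [set` K]) (W y @^-1` (int_shift (k y) @^-1` [set g y])).
  apply/seteqP; split=> w /= Hw y.
    by rewrite /= inE => /Hw.
  by move=> ya; apply: Hw; rewrite /= inE.
rewrite indep_W//; last by apply/fintype.subsetP => y; rewrite inE.
rewrite (eq_bigl (fun y => y != a)) => [|y]; last by rewrite inE.
apply: eq_bigr => y ya.
exact: (law_W _ ya (int_shift (k y) @^-1` [set g y])).
Qed.

Context {mu : probability {ffun Y -> int} R}.
Hypothesis muE : forall A, mu A = distribution P (group_sum a W) A.

(** Away from [a] the coordinates of the group sum are the independent [W y] themselves, and [v]
    only shifts each of them; it suffices to compare masses of points. Here [mu] is any law agreeing
    with that of the group sum, later the limit law at a boundary proportion. *)
Lemma drop_coord_law (v : {ffun Y -> int})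
    (A : set {ffun {y | y != a} -> int}) :
  distribution (shifted_law mu v) (drop_coord a) A =
  product_law (fun y : {y | y != a} =>
    shifted_Poi (v (val y)) (lam (val y))) A.
Proof.
rewrite (measure_esum_points (@countable_ffun_int _)
  (@measurable_set_ffun_int _)).
apply: eq_esum => g _.
(* [g'] extends [g] to all of [Y], with default value 0 at the dropped coordinate [a]. *)
pose g' y : int := if insub y is Some z then g z else 0.
have g'E (y : {y | y != a}) : g' (val y) = g y by rewrite /g' valK.
transitivity (P [set w | forall y, y != a -> v y + (W y w)%:Z = g' y]).
  rewrite -[LHS]/(mu _) muE; congr (P _); apply/seteqP; split=> w /=.
    move=> gE y ya; rewrite -[y]/(val (Sub y ya : {y | y != a})) g'E -gE.
    by rewrite /drop_coord /translate !ffunE /= group_sum_coord// addrC.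
  move=> Hw; apply/ffunP => y; rewrite /drop_coord /translate !ffunE /=.
  by rewrite group_sum_coord ?(valP y)// addrC Hw ?g'E ?(valP y).
rewrite probability_group_values.
transitivity (\prod_(i : {y | y != a})
    shifted_Poi (v (val i)) (lam (val i)) [set g' (val i)])%E.
  exact: (big_sub [pred y | y != a]
    (fun y => shifted_Poi (v y) (lam y) [set g' y])).
by apply: eq_bigr => i _; rewrite g'E.
Qed.

(** A group sum has total 0, which the indicator records; under this constraint the independent
    coordinates away from [a] determine the one at [a]. *)
Lemma mass_group_sum (h : {ffun Y -> int}) :
  mass mu h =
  (\sum_y h y == 0)%:R * \prod_(y | y != a) poisson_mass (lam y) (h y).
Proof.
rewrite /mass muE; case: eqP => [h0|nh0]; last first.
  have -> : distribution P (group_sum a W) [set h] = P set0.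
    congr (P _); apply/seteqP; split=> // w /= wh; apply: nh0.
    by rewrite -wh group_sum_total.
  by rewrite measure0 mul0r.
have -> : distribution P (group_sum a W) [set h] =
    P [set w | forall y, y != a -> 0 + (W y w)%:Z = h y].
  congr (P _); apply/seteqP; split=> w /=.
    by move=> <- y ya; rewrite group_sum_coord// add0r.
  move=> Hw; have hE y : y != a -> group_sum a W w y = h y.
    by move=> ya; rewrite group_sum_coord// -Hw// add0r.
  apply/ffunP => y; have [->|/hE//] := eqVneq y a.
  (* Both vectors have total 0 and agree away from [a]; cancelling the common sum leaves equality at
     [a]. *)
  move: (etrans (group_sum_total w) (esym h0)).
  rewrite (bigD1 a)//= [RHS](bigD1 a)//=.
  by rewrite (eq_bigr h)// => /addIr.
rewrite probability_group_values.
rewrite (eq_bigr (fun y => (poisson_mass (lam y) (h y))%:E)) => [|y _].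
  by rewrite prodEFin mul1r.
exact: (massE measurable_set_int (shifted_Poi 0 (lam y))).
Qed.

Context {b : Y} (ba : b != a).

(** The coordinate at [b] is a sufficient statistic: the switch preserves the total and the
    coordinates other than [a] and [b], so their contribution [w] is a common factor. Two arbitrary
    multiples of the switch cover both orders of the pair and both signs. *)
Lemma privacy_curve_group (m m' : int) (eps : R) :
  privacy_curve (shifted_law mu (switch_vec a b *~ m))
    (shifted_law mu (switch_vec a b *~ m')) eps =
  privacy_curve (shifted_Poi m (lam b)) (shifted_Poi m' (lam b)) eps.
Proof.
pose w (h : {ffun Y -> int}) : R := (\sum_y h y == 0)%:R *
  \prod_(y | (y != a) && (y != b)) poisson_mass (lam y) (h y).
have marginal k B :
    shifted_law mu (switch_vec a b *~ k) ((fun h => h b) @^-1` B) =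
    shifted_Poi k (lam b) B.
  rewrite -[LHS]/(mu _) muE -[RHS]/(Poi (lam b) _) -(law_W _ ba).
  congr (P _); apply/seteqP; split=> x /=;
    by rewrite /translate /int_shift ffunE group_sum_coord// ffunMzE
      switch_vecE eqxx (negPf ba) subr0 intz addrC.
have factor k h : mass (shifted_law mu (switch_vec a b *~ k)) h =
    w h * mass (shifted_Poi k (lam b)) (h b).
  have total : \sum_y (h - switch_vec a b *~ k) y = \sum_y h y.
    under eq_bigr do rewrite 2!ffunE ffunMzE.
    by rewrite sumrB -mulrz_suml sum_switch_vec mul0rz subr0.
  rewrite mass_shifted_law mass_group_sum total mass_shifted_Poi /w -mulrA.
  congr (_ * _); rewrite (bigD1 b)//= mulrC !ffunE ffunMzE switch_vecE.
  rewrite eqxx (negPf ba) subr0 mulr1n intz; congr (_ * _).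
  apply: eq_bigr => y /andP[ya yb]; rewrite !ffunE ffunMzE switch_vecE.
  by rewrite (negPf ya) (negPf yb) subrr mul0rz subr0.
apply: (privacy_curve_sufficient (@countable_ffun_int _)
  (@measurable_set_ffun_int _) countable_int measurable_set_int _ _ _ _ _ _ _
  (marginal m) (marginal m') _ (factor m) (factor m')).
move=> h; rewrite mulr_ge0// prodr_ge0// => y _; exact: mass_ge0.
Qed.

Local Notation shift v := (shifted_law mu v).

Lemma drop_coord_law0 (A : set {ffun {y : Y | y != a} -> int}) :
  distribution mu (drop_coord a) A =
  product_law (fun y : {y : Y | y != a} => shifted_Poi 0 (lam (val y))) A.
Proof.
have -> : distribution mu (drop_coord a) A =
    distribution (shift 0) (drop_coord a) A by exact/esym/shifted_law0.
rewrite drop_coord_law.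
by congr (product_law _ A); apply/funext => y; rewrite ffunE.
Qed.

(** Once [a] is dropped, the switch vector is the unit vector at [b], so one coordinate alone is
    shifted. *)
Lemma drop_coord_law_switch (m : int) (A : set {ffun {y : Y | y != a} -> int}) :
  distribution (shift (switch_vec a b *~ m)) (drop_coord a) A =
  product_law (fun y : {y : Y | y != a} =>
    shifted_Poi (if val y == b then m else 0) (lam (val y))) A.
Proof.
rewrite drop_coord_law.
congr (product_law _ A); apply/funext => y.
rewrite ffunMzE switch_vecE (negPf (valP y)) subr0.
by case: (val y == b); rewrite ?intz ?mul0rz.
Qed.

Lemma privacy_curve_switch_l (m : int) (eps : R) :
  privacy_curve (shift (switch_vec a b *~ m)) mu eps =
  privacy_curve (shifted_Poi m (lam b)) (shifted_Poi 0 (lam b)) eps.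
Proof.
rewrite -(privacy_curve_group m 0 eps).
by apply: eq_privacy_curve => // A; rewrite mulr0z shifted_law0.
Qed.

Lemma privacy_curve_switch_r (m : int) (eps : R) :
  privacy_curve mu (shift (switch_vec a b *~ m)) eps =
  privacy_curve (shifted_Poi 0 (lam b)) (shifted_Poi m (lam b)) eps.
Proof.
rewrite -(privacy_curve_group 0 m eps).
by apply: eq_privacy_curve => // A; rewrite mulr0z shifted_law0.
Qed.

End SingleGroup.

(** * Scalar Poisson shifts *)

Lemma privacy_curve_shifted_Poi {R : realType} (j k l : int) (lam eps : R) :
  privacy_curve (shifted_Poi (j + k) lam) (shifted_Poi (j + l) lam) eps =
  privacy_curve (shifted_Poi k lam) (shifted_Poi l lam) eps.
Proof.
have law (m : int) (B : set int) :
    shifted_Poi (j + m) lam ((fun x => x - j) @^-1` B) =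
    shifted_Poi m lam B.
  have shiftE x : int_shift (j + m) x - j = int_shift m x.
    by rewrite /int_shift addrC !addrA addNr add0r.
  by congr (Poi lam _); apply/seteqP; split=> x /=; rewrite shiftE.
(* Subtracting [j] is a bijection of the integers, so the common factor is 1. *)
have factor (m x : int) : mass (shifted_Poi (j + m) lam) x =
    1 * mass (shifted_Poi m lam) (x - j).
  by rewrite mul1r !mass_shifted_Poi opprD addrA.
apply: (privacy_curve_sufficient countable_int measurable_set_int countable_int
  measurable_set_int _ _ _ _ (fun x => x - j) (fun=> 1) _
  (law k) (law l) _ (factor k) (factor l)).
by [].
Qed.

Lemma poisson_mass_lt0 {R : realType} (lam : R) (j : int) :
  j < 0 -> poisson_mass lam j = 0.
Proof.
case: j => // n _; rewrite /poisson_mass /mass.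
have -> : shifted_Poi 0 lam [set Negz n] = Poi lam set0.
  by congr (Poi lam _); apply/seteqP; split=> x.
by rewrite measure0.
Qed.

(** Turns the unordered sum over the integers into a series over the natural numbers, which [Posz]
    embeds as the nonnegative integers. *)
Lemma esum_int_ge0 {R : realType} (f : int -> \bar R) :
  (forall k, (0 <= f k)%E) -> (forall k, k < 0 -> f k = 0%E) ->
  (\esum_(k in [set: int]) f k = \sum_(0 <= j <oo) f j%:Z)%E.
Proof.
move=> f0 fN; rewrite nneseries_esumT => [|n]; last exact: f0.
rewrite -(@reindex_esum _ _ _ setT [set k : int | 0 <= k] Posz); last first.
  split=> [n _ //|m n _ _ [//]|[n _|//]]; by exists n.
rewrite [RHS]esum_mkcond; apply: eq_esum => k _; case: ifPn => //.
by rewrite notin_setE /= => /negP; rewrite -ltNge => /fN.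
Qed.

Lemma privacy_curve_shifted_Poi10 {R : realType} (lam eps : R) :
  privacy_curve (shifted_Poi 1 lam) (shifted_Poi 0 lam) eps =
  poisson_shift_series lam eps.
Proof.
rewrite (privacy_curve_esum countable_int measurable_set_int).
rewrite esum_int_ge0 => [|k|k k0].
- by apply: eq_eseriesr => n _; rewrite !mass_shifted_Poi subr0.
- by rewrite lee_fin /pos_part le_max lexx orbT.
- rewrite !mass_shifted_Poi !poisson_mass_lt0 ?mulr0 ?subr0 /pos_part ?maxxx//.
  lra.
Qed.

(** The pair in reversed order. In the term [j = 0] the subtracted mass at -1 is 0, so that term is
    the full mass at 0. *)
Lemma privacy_curve_shifted_Poi01 {R : realType} (lam eps : R) :
  privacy_curve (shifted_Poi 0 lam) (shifted_Poi 1 lam) eps =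
  (\sum_(0 <= j <oo)
    (pos_part (poisson_mass lam j%:Z
               - expR eps * poisson_mass lam (j%:Z - 1)))%:E)%E.
Proof.
rewrite (privacy_curve_esum countable_int measurable_set_int).
rewrite esum_int_ge0 => [|k|k k0].
- by apply: eq_eseriesr => n _; rewrite !mass_shifted_Poi subr0.
- by rewrite lee_fin /pos_part le_max lexx orbT.
- rewrite !mass_shifted_Poi !poisson_mass_lt0 ?mulr0 ?subr0 /pos_part ?maxxx//.
  lra.
Qed.

(** * Rate zero, almost sure equality, and differences of independent variables *)

Lemma Poi0 {R : realType} (B : set nat) : (Poi (0 : R) B = \d_0%N B)%E.
Proof. by rewrite /Poi /= /poisson_prob ltxx. Qed.

Section AlmostSure.
Context {R : realType} {d : measure_display} {Omega : measurableType d}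
  (P : probability Omega R).

(** The part of [A] outside [B] lies in a null set [N], and adjoining [N] to [B] does not change its
    probability. *)
Lemma ae_le_probability (A B : set Omega) : measurable A -> measurable B ->
  {ae P, forall w, A w -> B w} -> (P A <= P B)%E.
Proof.
move=> mA mB [N [mN PN AB]].
rewrite -(@measureU0 _ _ _ P B N)// le_measure ?inE//; first exact: measurableU.
move=> w Aw; have [Bw|nBw] := pselect (B w); [by left|right].
by apply: AB => /= /(_ Aw).
Qed.

Lemma ae_eq_distribution {d'} {T : measurableType d'} (X Z : {RV P >-> T})
    (A : set T) : measurable A -> {ae P, forall w, X w = Z w} ->
  distribution P X A = distribution P Z A.
Proof.
move=> mA XZ; have mX (V : {RV P >-> T}) : measurable (V @^-1` A).
  by rewrite -[V @^-1` A]setTI; exact: measurable_funPT.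
apply/eqP; rewrite eq_le; apply/andP; split; apply: ae_le_probability => //.
  by apply: filterS XZ => w /= ->.
by apply: filterS XZ => w /= ->.
Qed.

Context {Y : finType}.

Lemma ae_group_sum0 (a : Y) (W : Y -> {RV P >-> nat}) :
  (forall y, y != a -> forall B, distribution P (W y) B = Poi 0 B) ->
  {ae P, forall w, group_sum a W w = 0}.
Proof.
move=> law0.
(* [Y] is finite, so the almost sure events for the single variables hold simultaneously; each [W y]
   is nonzero only on a null set, its law being the point mass at 0. *)
have : {ae P, forall w, forall y, y != a -> W y w = 0%N}.
  apply: filter_forall => y; have [->|ya] := eqVneq y a; first exact: aeW.
  exists (W y @^-1` ~` [set 0%N]); split=> //.
  - by rewrite -[X in measurable X]setTI; exact: measurable_funPT.
  - by rewrite -[LHS]/(distribution P (W y) _) law0// Poi0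
      diracE memNset//=; apply.
  - by move=> w /= nW W0; apply: nW.
apply: filterS => w W0; rewrite /group_sum big1// => y ya.
by rewrite W0// mulr0n.
Qed.

(** The hypothesis gives the joint law of the pair on rectangles, and a measure agreeing with the
    product measure there is the product measure. *)
Lemma probability_subtraction (X Z : {RV P >-> nat}) (l0 l1 : R) (C : set int) :
  (forall A B, P (X @^-1` A `&` Z @^-1` B) = (Poi l0 A * Poi l1 B)%E) ->
  P [set w | C ((X w)%:Z - (Z w)%:Z)] = Skellam l0 l1 C.
Proof.
move=> indep.
have mXZ : measurable_fun setT (fun w => (X w, Z w)).
  by apply/measurable_fun_pair => //; exact: measurable_funPT.
pose XZ : {mfun Omega >-> (nat * nat)%type} :=
  HB.pack (fun w => (X w, Z w)) (isMeasurableFun.Build _ _ _ _ _ mXZ).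
rewrite /Skellam /pushforward.
rewrite (product_measure_unique (m' := distribution P XZ))//.
  by move=> A B _ _; rewrite -indep.
(* Every set of pairs of natural numbers is measurable: there are countably many pairs, and each
   point is a rectangle. *)
apply: countable_measurable => [[m n]|]; last exact: countableP.
rewrite (_ : [set (m, n)] = [set m] `*` [set n]); first exact: measurableX.
by apply/seteqP; split=> [_ -> //|[x z] [/= -> ->]].
Qed.
End AlmostSure.

(** Independence passes to a subfamily relabelled by an injection; this extracts each group from the
    joint family. *)
Lemma mutually_independent_inj {R : realType} {d d'} {Omega : measurableType d}
    {T : measurableType d'} (P : probability Omega R) {J J' : finType}
    (X : J -> {RV P >-> T}) (I : {pred J}) (f : J' -> J) (I' : {pred J'}) :
  injective f -> (forall j, j \in I' -> f j \in I) ->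
  mutually_independent X I -> mutually_independent (fun j => X (f j)) I'.
Proof.
move=> injf fI indep K KI B mB.
(* [B'] carries [B] along [f] and takes the whole space off the image, so that it stays measurable
   at every index. *)
pose B' j := if [pick k | f k == j] is Some k then B k else setT.
have B'E k : B' (f k) = B k.
  rewrite /B'; case: pickP => [k' /eqP/injf -> //|/(_ k)]; by rewrite eqxx.
have mB' j : measurable (B' j) by rewrite /B'; case: pickP.
have fKI : (f @: K)%SET \subset I.
  apply/fintype.subsetP => _ /imsetP[j jK ->]; apply: fI.
  exact: (fintype.subsetP KI).
have := indep _ fKI _ mB'; rewrite big_imset//=;
  last by move=> ? ? _ _; exact: injf.
under eq_bigr do rewrite B'E.
move=> <-; congr (P _); apply/seteqP; split=> w /= Hw j.
  by move=> /imsetP[k kK ->]; rewrite B'E; exact: Hw.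
by move=> jK; rewrite /= -B'E; apply: Hw; exact: imset_f.
Qed.

(** Evaluation is named so that it can carry the structure of a measurable function and have a
    distribution. *)
Definition coord {Y : finType} (y : Y) (h : {ffun Y -> int}) : int := h y.

Lemma measurable_coord {Y : finType} (y : Y) : measurable_fun setT (coord y).
Proof. by []. Qed.
HB.instance Definition _ (Y : finType) (y : Y) :=
  isMeasurableFun.Build _ _ _ _ (coord y) (measurable_coord y).

(** * The limit model: independence and conservation of the total *)

Section LimitModel.
Context {R : realType} {Y : finType} {y0 y1 : Y} (neq_y : y0 != y1)
  {prop1 : R} {alpha0 alpha1 : Y -> R}
  {d : measure_display} {Omega : measurableType d} {P : probability Omega R}
  {U V : Y -> {RV P >-> nat}}.
Hypothesis model : limit_model y0 y1 prop1 alpha0 alpha1 U V.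

Local Notation Pinf := (P_infty y0 y1 U V).
Local Notation Qinf := (Q_infty y0 y1 U V).

Lemma indep_U : mutually_independent U (fun y => y != y0).
Proof.
exact: (mutually_independent_inj _ _ _ inl _ inl_inj _ (indep_UV model)).
Qed.

Lemma indep_V : mutually_independent V (fun y => y != y1).
Proof.
exact: (mutually_independent_inj _ _ _ inr _ inr_inj _ (indep_UV model)).
Qed.

(** Independence for a pair of indices, one from each group; with two outputs these are the only
    active variables. *)
Lemma indep_switched (A B : set nat) :
  P (U y1 @^-1` A `&` V y0 @^-1` B) =
  (Poi ((1 - prop1) * alpha0 y1) A * Poi (prop1 * alpha1 y0) B)%E.
Proof.
pose K : {set Y + Y} := [set inl y1; inr y0]%SET.
have KI : K \subset active y0 y1.
  by apply/fintype.subsetP => k; rewrite !inE => /orP[] /eqP -> //=;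
    rewrite unfold_in /= 1?eq_sym.
have := indep_UV model KI (B := fun k => if k is inl _ then A else B).
rewrite big_setU1 ?inE//= big_set1 /=.
rewrite -(law_U model) 1?eq_sym// -(law_V model)// => <- => [|[]//].
congr (P _); apply/seteqP; split=> w /=.
  by move=> [Aw Bw] k /=; rewrite !inE => /orP[] /eqP ->.
move=> Hw; split; first by apply: (Hw (inl y1)); rewrite /= !inE eqxx.
by apply: (Hw (inr y0)); rewrite /= !inE eqxx orbT.
Qed.

Lemma histogram_total (w : Omega) : \sum_y histogram y0 y1 U V w y = 0.
Proof.
under eq_bigr do rewrite /histogram ffunE.
by rewrite big_split /= !group_sum_total addr0.
Qed.

Lemma mass_Q_infty h : mass Qinf h = mass Pinf (h - switch_vec y0 y1).
Proof. exact: mass_shifted_law. Qed.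

(** * Two outputs: reduction to a Skellam coordinate *)

Section TwoOutputs.
Hypothesis card_Y : #|Y| = 2%N.

Lemma two_outputs (y : Y) : (y == y0) || (y == y1).
Proof.
have /eqP E : [set y0; y1]%SET == [set: Y]%SET.
  by rewrite eqEcard finset.subsetT cardsT card_Y cards2 neq_y.
by have := finset.in_setT y; rewrite -E !inE.
Qed.

Lemma sum_two_outputs (h : {ffun Y -> int}) : \sum_y h y = h y0 + h y1.
Proof.
rewrite (bigD1 y0)//= (bigD1 y1) 1?eq_sym//= big1 ?addr0// => y.
by case/andP=> /negPf y0F /negPf y1F; have := two_outputs y; rewrite y0F y1F.
Qed.

(** The second group has total 0, so its coordinate at [y1] is minus its coordinate at [y0], which
    is [V y0]. *)
Lemma histogram_coord (w : Omega) :
  histogram y0 y1 U V w y1 = (U y1 w)%:Z - (V y0 w)%:Z.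
Proof.
rewrite /histogram ffunE group_sum_coord 1?eq_sym//; congr (_ + _).
have := group_sum_total (a := y1) (W := V) w.
rewrite sum_two_outputs group_sum_coord//.
by move=> /eqP; rewrite addrC addr_eq0 => /eqP.
Qed.

Lemma mass_coord_P (k : int) :
  mass (distribution Pinf (coord y1)) k =
  mass (Skellam ((1 - prop1) * alpha0 y1) (prop1 * alpha1 y0)) k.
Proof.
congr fine; rewrite -(probability_subtraction _ _ _ _ _ _ indep_switched).
congr (P _); apply/seteqP; split=> w /=; by rewrite /coord histogram_coord.
Qed.

Lemma mass_coord_Q (k : int) :
  mass (distribution Qinf (coord y1)) k =
  mass (distribution Pinf (coord y1)) (k - 1).
Proof.
congr (fine (Pinf _)).
apply/seteqP; split=> h /=; rewrite /coord /translate ffunE switch_vecE eqxx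
  eq_sym (negPf neq_y) subr0.
  by move=> <-; rewrite addrK.
by move=> ->; rewrite subrK.
Qed.

(** With two outputs and total 0, the coordinate at [y1] determines the histogram. *)
Lemma mass_P_infty_two (h : {ffun Y -> int}) :
  mass Pinf h =
  (\sum_y h y == 0)%:R * mass (distribution Pinf (coord y1)) (h y1).
Proof.
case: eqP => [h0|nh0].
  rewrite mul1r; congr (fine (P _)).
  apply/seteqP; split=> w /=; first by move=> ->.
  rewrite /coord => wh; apply/ffunP => y; have := histogram_total w.
  rewrite -[in RHS]h0 !sum_two_outputs wh => /addIr wh0.
  by have /orP[] := two_outputs y => /eqP ->.
rewrite mul0r /mass; have -> : Pinf [set h] = P set0.
  congr (P _); apply/seteqP; split=> // w /= wh; apply: nh0.
  by rewrite -wh histogram_total.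
by rewrite measure0.
Qed.

Lemma privacy_curve_two_outputs (eps : R) :
  privacy_curve Qinf Pinf eps =
  privacy_curve (distribution Qinf (coord y1))
    (distribution Pinf (coord y1)) eps.
Proof.
(* The common factor is the indicator of total 0, which the switch leaves unchanged. *)
pose w (h : {ffun Y -> int}) : R := (\sum_y h y == 0)%:R.
apply: (privacy_curve_sufficient (@countable_ffun_int _)
  (@measurable_set_ffun_int _) countable_int measurable_set_int _ _ _ _
  (coord y1) w) => // [h|h].
  rewrite mass_Q_infty mass_P_infty_two mass_coord_Q /w.
  have -> : \sum_y (h - switch_vec y0 y1) y = \sum_y h y.
    under eq_bigr do rewrite 2!ffunE.
    by rewrite sumrB sum_switch_vec subr0.
  by rewrite !ffunE eqxx (eq_sym y1) (negPf neq_y) subr0.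
exact: mass_P_infty_two.
Qed.

End TwoOutputs.

(** * Boundary proportions: one group vanishes almost surely *)

Lemma P_infty_0group : prop1 = 0 ->
  forall A, Pinf A = distribution P (group_sum y0 U) A.
Proof.
move=> p0 A; apply: ae_eq_distribution => //.
have /filterS : {ae P, forall w, group_sum y1 V w = 0}.
  by apply: ae_group_sum0 => y yy1 B; rewrite (law_V model)// p0 mul0r.
by apply=> w V0; rewrite /= /histogram V0 addr0.
Qed.

Lemma P_infty_1group : prop1 = 1 ->
  forall A, Pinf A = distribution P (group_sum y1 V) A.
Proof.
move=> p1 A; apply: ae_eq_distribution => //.
have /filterS : {ae P, forall w, group_sum y0 U w = 0}.
  by apply: ae_group_sum0 => y yy0 B; rewrite (law_U model)// p1 subrr mul0r.
by apply=> w U0; rewrite /= /histogram U0 add0r.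
Qed.

End LimitModel.

Theorem corollary5p11 (R : realType) (Y : finType) (y0 y1 : Y)
    (neq_y : y0 != y1)
    (prop1 : R) (prop1_ge0 : 0 <= prop1) (prop1_le1 : prop1 <= 1)
    (alpha0 alpha1 : Y -> R)
    (alpha0_ge0 : forall y, y != y0 -> 0 <= alpha0 y)
    (alpha1_ge0 : forall y, y != y1 -> 0 <= alpha1 y)
    (d : measure_display) (Omega : measurableType d) (P : probability Omega R)
    (U V : Y -> {RV P >-> nat})
    (model : limit_model y0 y1 prop1 alpha0 alpha1 U V) :
  let Pinf := P_infty y0 y1 U V in
  let Qinf := Q_infty y0 y1 U V in
  let p := mass Pinf in
  let e := switch_vec y0 y1 in
  [/\ (forall h : {ffun Y -> int}, mass Qinf h = p (h - e)),
      (forall eps : R, 0 <= eps ->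
        privacy_curve Qinf Pinf eps =
        \esum_(h in [set: {ffun Y -> int}])
          (pos_part (p (h - e) - expR eps * p h))%:E),
      (#|Y| = 2%N ->
        let s := mass (Skellam ((1 - prop1) * alpha0 y1) (prop1 * alpha1 y0)) in
        forall eps : R, 0 <= eps ->
        \esum_(h in [set: {ffun Y -> int}])
          (pos_part (p (h - e) - expR eps * p h))%:E =
        \esum_(k in [set: int])
          (pos_part (s (k - 1) - expR eps * s k))%:E),
      (prop1 = 0 ->
        [/\ (forall A, Pinf A = distribution P (group_sum y0 U) A),
            (forall A, distribution Pinf (drop_coord y0) A =
              product_law (fun y : {y : Y | y != y0} =>
                shifted_Poi 0 (alpha0 (val y))) A),
            (forall A, distribution Qinf (drop_coord y0) A =
              product_law (fun y : {y : Y | y != y0} =>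
                shifted_Poi (if val y == y1 then 1 else 0)
                            (alpha0 (val y))) A) &
            (forall eps : R, 0 <= eps ->
              privacy_curve Qinf Pinf eps =
                privacy_curve (shifted_Poi 1 (alpha0 y1))
                              (shifted_Poi 0 (alpha0 y1)) eps /\
              privacy_curve Qinf Pinf eps =
                poisson_shift_series (alpha0 y1) eps)]) &
      (prop1 = 1 ->
        (* the labels 0 and 1 are exchanged, so the switch is - e *)
        let Qrev := shifted_law Pinf (switch_vec y1 y0) in
        [/\ (forall A, Pinf A = distribution P (group_sum y1 V) A),
            (forall A, distribution Pinf (drop_coord y1) A =
              product_law (fun y : {y : Y | y != y1} =>
                shifted_Poi 0 (alpha1 (val y))) A),
            (forall A, distribution Qrev (drop_coord y1) A =
              product_law (fun y : {y : Y | y != y1} =>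
                shifted_Poi (if val y == y0 then 1 else 0)
                            (alpha1 (val y))) A),
            (forall eps : R, 0 <= eps ->
              [/\ privacy_curve Qrev Pinf eps =
                    privacy_curve (shifted_Poi 1 (alpha1 y0))
                                  (shifted_Poi 0 (alpha1 y0)) eps,
                  privacy_curve Qrev Pinf eps =
                    poisson_shift_series (alpha1 y0) eps &
                  privacy_curve Pinf Qinf eps =
                    poisson_shift_series (alpha1 y0) eps]) &
            (* the same case for Q_infty = L(H_infty + e) itself: the shifted
               coordinate loses 1 *)
            (forall A, distribution Qinf (drop_coord y1) A =
              product_law (fun y : {y : Y | y != y1} =>
                shifted_Poi (if val y == y0 then -1 else 0)
                            (alpha1 (val y))) A) /\
            (forall eps : R, 0 <= eps ->
              privacy_curve Qinf Pinf eps =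
                privacy_curve (shifted_Poi 0 (alpha1 y0))
                              (shifted_Poi 1 (alpha1 y0)) eps /\
              privacy_curve Qinf Pinf eps =
                (\sum_(0 <= j <oo)
                  (pos_part (poisson_mass (alpha1 y0) j%:Z
                     - expR eps * poisson_mass (alpha1 y0) (j%:Z - 1)))%:E)%E)])].
Proof.
have neq_y' : y1 != y0 by rewrite eq_sym.
have curveE eps : privacy_curve (Q_infty y0 y1 U V) (P_infty y0 y1 U V) eps =
    \esum_(h in [set: {ffun Y -> int}])
      (pos_part (mass (P_infty y0 y1 U V) (h - switch_vec y0 y1)
                 - expR eps * mass (P_infty y0 y1 U V) h))%:E.
  rewrite (privacy_curve_esum (@countable_ffun_int _)
    (@measurable_set_ffun_int _)).
  by apply: eq_esum => h _; rewrite mass_Q_infty.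
move=> Pinf Qinf p e; split.
- exact: mass_Q_infty.
- by move=> eps _; exact: curveE.
(* The series over histograms is read back as a privacy curve, moved to the coordinate at [y1], and
   expanded again as a series over the integers. *)
- move=> card_Y s eps _; rewrite -curveE (privacy_curve_two_outputs neq_y)//.
  rewrite (privacy_curve_esum countable_int measurable_set_int).
  apply: eq_esum => k _.
  by rewrite (mass_coord_Q neq_y) !(mass_coord_P neq_y model card_Y).
- move=> p0.
  have law y : y != y0 -> forall B : set nat,
      distribution P (U y) B = Poi (alpha0 y) B.
    by move=> yy0 B; rewrite (law_U model)// p0 subr0 mul1r.
  have PinfE := P_infty_0group model p0.
  have QE : Qinf = shifted_law Pinf (switch_vec y0 y1 *~ 1) by rewrite mulr1z.
  have indep := indep_U model.
  split=> [//|A|A|eps _].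
  + exact: (drop_coord_law0 law indep PinfE).
  + by rewrite QE (drop_coord_law_switch law indep PinfE).
  + rewrite QE (privacy_curve_switch_l law indep PinfE neq_y').
    by rewrite privacy_curve_shifted_Poi10.
- move=> p1 Qrev.
  have law y : y != y1 -> forall B : set nat,
      distribution P (V y) B = Poi (alpha1 y) B.
    by move=> yy1 B; rewrite (law_V model)// p1 mul1r.
  have PinfE := P_infty_1group model p1.
  have QrevE : Qrev = shifted_law Pinf (switch_vec y1 y0 *~ 1).
    by rewrite mulr1z.
  (* With the labels exchanged the switch changes sign, so [Qinf] is the shift by -1 times the
     reversed switch. *)
  have QE : Qinf = shifted_law Pinf (switch_vec y1 y0 *~ -1).
    by rewrite mulrN1z switch_vecN.
  have indep := indep_V model.
  (* Raising both shifts by 1 brings the pair (0, -1) to (1, 0) and the pair (-1, 0) to (0, 1), the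
     two forms with an explicit series. *)
  have shift_up eps k l : privacy_curve (shifted_Poi k (alpha1 y0))
      (shifted_Poi l (alpha1 y0)) eps =
      privacy_curve (shifted_Poi (1 + k) (alpha1 y0))
        (shifted_Poi (1 + l) (alpha1 y0)) eps.
    by rewrite privacy_curve_shifted_Poi.
  split=> [//|A|A|eps _|].
  + exact: (drop_coord_law0 law indep PinfE).
  + by rewrite QrevE (drop_coord_law_switch law indep PinfE).
  + rewrite QrevE QE (privacy_curve_switch_l law indep PinfE neq_y).
    rewrite (privacy_curve_switch_r law indep PinfE neq_y).
    by rewrite [privacy_curve _ (shifted_Poi (-1) _) _]shift_up addr0 subrr
      privacy_curve_shifted_Poi10.
  + split=> [A|eps _].
      by rewrite QE (drop_coord_law_switch law indep PinfE).
    rewrite QE (privacy_curve_switch_l law indep PinfE neq_y).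
    by rewrite shift_up addr0 subrr privacy_curve_shifted_Poi01.
Qed.
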